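(* Let $A$ and $B$ be closed convex sets in $\mathbb{E}$ with nonempty intersection. (1) If the collection of sets $\{A,B\}$ is subtransversal at every point $x$ of the boundary of $A\cap B$ with constants $\mathrm{sr}'[A,B](x)$ bounded from above by $\kappa<+\infty$, then for any number $c\in[0,1)$ with $c\in(1-\kappa^{-2},1)$, every alternating projections iteration converges R-linearly to a point in $A\cap B$ with rate not greater than $c$. (2) Conversely, if there exists a number $c\in[0,1)$ such that every alternating projections sequence eventually converges R-linearly to a point in $A\cap B$ with rate not greater than $c$, then the collection of sets $\{A,B\}$ is globally subtransversal with constant $\kappa\le\frac1{1-c}$, that is, $$\operatorname{dist}(x,A\cap B)\le\frac{1}{1-c}\operatorname{dist}(x,B)\quad\forall x\in A.$$
   Context: $\mathbb{E}$ is a Euclidean space; $\operatorname{dist}(x,C):=\inf_{a\in C}\|x-a\|$; $\mathbb{B}_\delta(x)$ is the open ball; $P_C$ is the (single-valued) projection onto the nonempty closed convex set $C$. Alternating projections sequence: $x_{k+1}=P_AP_Bx_k$ for all $k\in\mathbb{N}$, with starting point $x_0\in A$ (standing assumption). R-linear convergence to $\tilde x$ with rate $c\in[0,1)$: there is $\gamma>0$ with $\|x_k-\tilde x\|\le\gamma c^k$ for all $k\in\mathbb{N}$. Eventual R-linear convergence to $\tilde x$ with rate $c$: there are $p\in\mathbb{N}$ and $\gamma'>0$ with $\|x_k-\tilde x\|\le\gamma' c^{k-p}$ for all $k\ge p$. Subtransversality: $\{A,B\}$ is subtransversal at $\bar x\in A\cap B$ if there are $\delta>0$, $\kappa\ge0$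 with $\operatorname{dist}(x,A\cap B)\le\kappa\max\{\operatorname{dist}(x,A),\operatorname{dist}(x,B)\}$ for all $x\in\mathbb{B}_\delta(\bar x)$. $\mathrm{sr}'[A,B](\bar x)$ denotes the infimum of all $\kappa\ge0$ for which there is $\delta>0$ with $\operatorname{dist}(x,A\cap B)\le\kappa\operatorname{dist}(x,B)$ for all $x\in A\cap\mathbb{B}_\delta(\bar x)$; subtransversality at $\bar x$ is equivalent to $\mathrm{sr}'[A,B](\bar x)<+\infty$. Convention: $0^{-2}=+\infty$. *)

(* Defs.v *)
(* MathComp-Analysis *)
From HB Require Import structures.
From mathcomp Require Import all_boot all_order all_algebra.
From mathcomp Require Import sesquilinear.
From mathcomp Require Import all_classical all_reals all_analysis.

Set Implicit Arguments.
Unset Strict Implicit.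
Unset Printing Implicit Defensive.

Import Order.TTheory GRing.Theory Num.Theory.
Import numFieldNormedType.Exports.

Local Open Scope classical_set_scope.
Local Open Scope ring_scope.

(* Euclidean space: a finite-dimensional (Vector) normed R-module whose norm is
   induced by an inner product.  The matrix types 'rV[R]_n are not used because
   their library norm is the sup norm. *)
HB.mixin Record isEuclidean (R : realType) E
    of NormedModule R E & Vector R E := {
  inner : {dot E for (@idfun R)} ;
  sqr_normE : forall x : E, `|x| ^+ 2 = inner x x
}.

#[short(type="euclideanType")]
HB.structure Definition Euclidean (R : realType) :=
  {E of NormedModule R E & Vector R E & isEuclidean R E}.

Section Definitions.
Context {R : realType} {E : euclideanType R}.
Implicit Types (A B C : set E) (x xbar xt : E) (u : nat -> E) (c kappa : R).

Definition dist x C : R := inf [set `|x - a| | a in C].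

(* The junk value 0 is only returned when no nearest point exists, which cannot
   happen for C nonempty, closed and convex. *)
Definition proj C x : E := xget 0 [set p | C p /\ `|x - p| = dist x C].

Definition boundary C : set E := closure C `\` interior C.

Definition alternating_projections A B u : Prop :=
  A (u 0%N) /\ forall k, u k.+1 = proj A (proj B (u k)).

(* With c = 0, the convention 0 ^+ 0 = 1 is in force. *)
Definition Rlinear_cvg u xt c : Prop :=
  0 <= c < 1 /\
  exists2 gamma : R, 0 < gamma & forall k, `|u k - xt| <= gamma * c ^+ k.

Definition eventually_Rlinear_cvg u xt c : Prop :=
  0 <= c < 1 /\
  exists p : nat, exists2 gamma : R, 0 < gamma &
    forall k, (p <= k)%N -> `|u k - xt| <= gamma * c ^+ (k - p).

Definition subtransversal A B xbar : Prop :=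
  exists delta kappa : R, [/\ 0 < delta, 0 <= kappa &
    forall x, ball xbar delta x ->
      dist x (A `&` B) <= kappa * Num.max (dist x A) (dist x B)].

(* +oo when there is no such kappa *)
Definition sr' A B xbar : \bar R :=
  ereal_inf [set kappa%:E | kappa in [set kappa : R | 0 <= kappa /\
    exists2 delta : R, 0 < delta & forall x, A x -> ball xbar delta x ->
      dist x (A `&` B) <= kappa * dist x B]].

End Definitions.

(* kappa^-2 with the convention 0^-2 = +oo *)
Definition inv_sqr {R : realType} (kappa : R) : \bar R :=
  if kappa == 0 then +oo%E else (kappa ^- 2)%:E.

(* Main.v *)
Require Import Defs.
From HB Require Import structures.
From mathcomp Require Import all_boot all_order all_algebra.
From mathcomp Require Import sesquilinear.
From mathcomp Require Import all_classical all_reals all_analysis.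
From mathcomp Require Import ring lra.

(** Write C for the intersection of A and B, and P_A, P_B, P_C for the
    projections.

    First part.  A point x of A, its projection z = P_C x and the segment
    between them reduce the local estimates to a global one: every point of the
    segment projects to z, so its distance to C shrinks proportionally as it
    approaches z, while its distance to B shrinks at least as fast.  Hence the
    bound on sr' at the boundary point z gives dist(x, C) <= kappa dist(x, B)
    for every x in A ([error_bound_of_local]).  This is equivalent to a bound
    on angles ([angle_bound]): with q = sqrt(1 - kappa^-2), for a in A, b in B
    and z = P_C a, the cosine of the angle between a - z and b - z is at most
    q.  Although the hypothesis only concerns points of A, the angle bound is
    symmetric in A and B ([angle_bound_sym]): for b in B, w = P_C b and a in A,
    apply it to w + t (a - w) and let t tend to 0.  Each of the two projections
    of an iteration therefore multiplies the distance to C by at most q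
    ([dist_proj_contraction]), and a full iteration by at most
    q^2 = 1 - kappa^-2.  The iterates are Fejer monotone with respect to C, so
    they converge to a point of C as fast as their distance to C tends to 0
    ([Fejer_Rlinear_cvg]).  When kappa < 1, the estimate holds a fortiori with
    kappa = 1, for which q = 0.

    Second part.  Along the points produced alternately by P_B and P_A, the
    successive gaps are log-convex: the square of a gap is at most the product
    of its two neighbours ([gap_log_convex]).  Hence the numbers
    e_k = dist(x_k, B) are log-convex too, and their successive ratios
    increase.  Eventual linear convergence with rate c bounds e_k by a multiple
    of c^k, which forces every ratio, the first one included, to be at most c
    ([ratio_le_of_log_convex]).  Since P_A is nonexpansive,
    |x_k - x_(k+1)| <= e_k, and summing the geometric series bounds the distance
    from x_0 to the limit, a point of C, by e_0 / (1 - c). *)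

Import Order.TTheory GRing.Theory Num.Theory.
Import numFieldNormedType.Exports.

Local Open Scope classical_set_scope.
Local Open Scope ring_scope.
Set Implicit Arguments.
Unset Strict Implicit.

Local Notation "''[' u , v ]" := (inner u v) : ring_scope.
(* The nearest-point projection, as opposed to the coordinate projections of a
   product. *)
Local Notation proj := Defs.proj.

(** * Inner product and compactness of balls *)

Section EuclideanSpace.
Context {R : realType} {E : euclideanType R}.
Implicit Types (x y z : E) (t : R).

Lemma innerC x y : '[x, y] = '[y, x].
Proof. by rewrite hermC /= expr0 mul1r. Qed.

Lemma innerDl x y z : '[x + y, z] = '[x, z] + '[y, z].
Proof. exact: linearDl. Qed.

Lemma innerNl x z : '[- x, z] = - '[x, z].
Proof. exact: linearNl. Qed.

Lemma innerZl t x z : '[t *: x, z] = t * '[x, z].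
Proof. exact: linearZl_LR. Qed.

Lemma innerDr x y z : '[z, x + y] = '[z, x] + '[z, y].
Proof. by rewrite innerC innerDl !(innerC z). Qed.

Lemma innerNr x z : '[z, - x] = - '[z, x].
Proof. by rewrite innerC innerNl (innerC z). Qed.

Lemma innerZr t x z : '[z, t *: x] = t * '[z, x].
Proof. by rewrite innerC innerZl (innerC z). Qed.

Lemma inner0r x : '[x, 0] = 0.
Proof. by rewrite -(subrr 0) innerDr innerNr subrr. Qed.

Definition inner_expand :=
  (innerDl, innerNl, innerZl, innerDr, innerNr, innerZr).

(** The Cauchy-Schwarz inequality: expand the squared norm of
    |y| x - |x| y, which is nonnegative. *)
Lemma inner_le_norm x y : '[x, y] <= `|x| * `|y|.
Proof.
have H : 2 * (`|x| * `|y|) * '[x, y] <= 2 * (`|x| * `|y|) ^+ 2.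
  have : 0 <= `| `|y| *: x - `|x| *: y| ^+ 2 by rewrite sqr_ge0.
  rewrite sqr_normE !inner_expand -!sqr_normE (innerC y x).
  by lra.
have [/eqP|xy0] := eqVneq (`|x| * `|y|) 0.
  rewrite mulf_eq0 !normr_eq0 => /orP[]/eqP->.
    by rewrite innerC inner0r normr0 mul0r.
  by rewrite inner0r normr0 mulr0.
have xy : 0 < `|x| * `|y| by rewrite lt_neqAle eq_sym xy0 mulr_ge0.
by rewrite -(ler_pM2l xy); move: H; rewrite expr2; lra.
Qed.

(** A linear parametrization of E by row vectors, through which compactness is
    transported from the sup norm to the Euclidean norm. *)
Definition of_coords (v : 'rV[R]_(\dim {:E})) : E :=
  \sum_(i < \dim {:E}) v 0 i *: (vbasis {:E})`_i.

Lemma of_coords_surj x : exists v, of_coords v = x.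
Proof.
exists (\row_i coord (vbasis {:E}) i x).
rewrite [RHS](coord_vbasis (memvf x)).
by apply: eq_bigr => i _; rewrite mxE.
Qed.

Lemma of_coords_eq0 v : of_coords v = 0 -> v = 0.
Proof.
move=> v0; apply/rowP => i; rewrite mxE.
have /freeP free_basis := basis_free (vbasisP {:E}).
exact: (free_basis (fun i => v 0 i) v0).
Qed.

Lemma of_coordsZ t v : of_coords (t *: v) = t *: of_coords v.
Proof. by rewrite scaler_sumr; apply: eq_bigr => i _; rewrite mxE scalerA. Qed.

Lemma of_coords_continuous : continuous of_coords.
Proof.
apply: continuous_big; first exact: add_continuous.
move=> i _ v; apply: cvgZr_tmp; [exact: nbhs_filter|exact: coord_continuous].
Qed.

Lemma norm_of_coords_continuous : continuous (fun v => `|of_coords v|).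
Proof.
move=> v; apply: (@continuous_comp _ _ _ of_coords (fun y : E => `|y|)).
  exact: of_coords_continuous.
exact: norm_continuous.
Qed.

(** Half of the equivalence of norms in finite dimension: by injectivity, the
    continuous function |of_coords v| does not vanish on the compact unit
    sphere, so it is bounded below there by some m > 0. *)
Lemma of_coords_bounded_below :
  exists2 m : R, 0 < m & forall v, m * `|v| <= `|of_coords v|.
Proof.
pose S := [set v : 'rV[R]_(\dim {:E}) | `|v| = 1].
have Scompact : compact S.
  apply: bounded_closed_compact.
    by exists 1; split=> // M M1 v /= ->; exact: ltW.
  have /continuous_closedP h := @norm_continuous _ 'rV[R]_(\dim {:E}).
  exact: (h _ (@closed_eq _ 1)).
have scale v : v != 0 -> S (`|v|^-1 *: v).
  by move=> v0; rewrite /S /= normrZ normfV normr_id mulVf // normr_eq0.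
have of_coords0 : of_coords 0 = 0 by rewrite -(scale0r 0) of_coordsZ scale0r.
have [S0|S0] := pselect (S !=set0); last first.
  (* The unit sphere is empty only in dimension 0, where v = 0. *)
  exists 1 => // v; have [->|vn0] := eqVneq v 0.
    by rewrite of_coords0 !normr0 mulr0.
  by case: S0; exists (`|v|^-1 *: v); exact: scale.
have [|u uS umin] := @compact_EVT_min _ R (fun v => `|of_coords v|) S S0 Scompact.
  by apply: continuous_subspaceT; exact: norm_of_coords_continuous.
exists `|of_coords u|.
  rewrite normr_gt0; apply/eqP => /of_coords_eq0 u0.
  by move: uS; rewrite inE /S /= u0 normr0 => /esym/eqP; rewrite oner_eq0.
move=> v; have [->|vn0] := eqVneq v 0; first by rewrite of_coords0 !normr0 mulr0.
have := umin _ (mem_set (scale _ vn0)).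
by rewrite of_coordsZ normrZ normfV normr_id ler_pdivlMl ?normr_gt0 // mulrC.
Qed.

(** A ball of E is the continuous image of a closed set of coordinate vectors,
    bounded thanks to [of_coords_bounded_below]. *)
Lemma closed_ball_compact (M : R) : compact [set x : E | `|x| <= M].
Proof.
have [m m0 mP] := of_coords_bounded_below.
have -> : [set x : E | `|x| <= M] = of_coords @` [set v | `|of_coords v| <= M].
  rewrite eqEsubset; split=> [x /= xM|x /= [v vM <-]] //.
  by have [v vx] := of_coords_surj x; exists v; rewrite //= vx.
apply: continuous_compact.
  by apply: continuous_subspaceT; exact: of_coords_continuous.
apply: bounded_closed_compact.
  exists (M / m); split=> [|K MK v /= vM]; first exact: num_real.
  apply: ltW; apply: le_lt_trans MK.
  by rewrite ler_pdivlMr // mulrC (le_trans (mP v)).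
have /continuous_closedP h := norm_of_coords_continuous.
exact: (h _ (@closed_le _ M)).
Qed.

End EuclideanSpace.
(** * Distance and projection *)

Section Projection.
Context {R : realType} {E : euclideanType R}.
Implicit Types (x y z p : E) (t : R) (C : set E).

(** This is how the derivative at t = 0 is taken in the two variational
    arguments below, [proj_obtuse] and [angle_bound_sym]. *)
Lemma le0_of_small_multiples (a b : R) :
  (forall t, 0 < t <= 1 -> a <= t * b) -> a <= 0.
Proof.
move=> h; rewrite leNgt; apply/negP => a0.
have ab : a <= b by have := h 1; rewrite ltr01 lexx mul1r; exact.
have b0 : 0 < b by exact: lt_le_trans ab.
(* This value of t turns the bound into a <= a / 2. *)
have := h (a / (2 * b)); rewrite divr_gt0 ?mulr_gt0 //= ler_pdivrMr ?mulr_gt0 //.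
have -> : a / (2 * b) * b = a / 2 by field; rewrite gt_eqF.
by move=> /(_ ltac:(lra)); lra.
Qed.

Lemma sqr_normB x y : `|x - y| ^+ 2 = `|x| ^+ 2 - 2 * '[x, y] + `|y| ^+ 2.
Proof. by rewrite !sqr_normE !inner_expand (innerC y x); ring. Qed.

Lemma convex_set_segment C x y t : convex_set C -> C x -> C y ->
  0 <= t <= 1 -> C (x + t *: (y - x)).
Proof.
move=> cC Cx Cy /andP[t0 t1].
have := cC y x (Itv01 t0 t1) (mem_set Cy) (mem_set Cx).
rewrite inE; congr C; rewrite /conv /= scalerBl scalerBr scale1r.
by rewrite addrCA.
Qed.

Lemma dist_has_inf x C : C !=set0 -> has_inf [set `|x - a| | a in C].
Proof.
move=> [a Ca]; split; first by exists `|x - a|; exists a.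
by exists 0 => _ [b _ <-].
Qed.

Lemma dist_le x C a : C a -> dist x C <= `|x - a|.
Proof.
move=> Ca; apply: ge_inf; last by exists a.
by have [] := dist_has_inf x (ex_intro _ a Ca).
Qed.

Lemma le_dist x C r : C !=set0 -> (forall a, C a -> r <= `|x - a|) ->
  r <= dist x C.
Proof.
move=> C0 h; apply: lb_le_inf; first by have [] := dist_has_inf x C0.
by move=> _ [a Ca <-]; exact: h.
Qed.

(** Only the points of C no farther from x than some a in C compete, and they
    lie in a ball around 0, which is compact. *)
Lemma nearest_point_exists x C : closed C -> C !=set0 ->
  exists p, C p /\ `|x - p| = dist x C.
Proof.
move=> clC [a Ca].
pose K := C `&` [set y | `|y| <= `|x| + `|x - a|].
have Ka : K a.
  by split=> //=; rewrite -{1}(subKr x a) (le_trans (ler_normB _ _)).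
have cK : compact K.
  rewrite /K setIC; apply: compact_closedI => //; exact: closed_ball_compact.
have [|p] := @compact_EVT_min _ R (fun y => `|x - y|) K (ex_intro _ a Ka) cK.
  apply: continuous_subspaceT => y.
  apply: (@continuous_comp _ _ _ (fun y => x - y) (fun y : E => `|y|)).
    by apply: continuousB; [exact: cst_continuous|exact: id].
  exact: norm_continuous.
rewrite inE => -[Cp _] pmin; exists p; split=> //.
apply/eqP; rewrite eq_le dist_le // andbT.
apply: le_dist; first by exists a.
move=> b Cb; have [xb|xb] := leP `|x - b| `|x - a|.
  apply: pmin; rewrite inE; split=> //=.
  by rewrite -{1}(subKr x b) (le_trans (ler_normB _ _)) // lerD2l.
by apply: (le_trans (pmin a (mem_set Ka))); exact: ltW.
Qed.

Lemma projP x C : closed C -> C !=set0 ->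
  C (proj C x) /\ `|x - proj C x| = dist x C.
Proof.
move=> clC C0; have [p Pp] := nearest_point_exists x clC C0.
exact: (xgetPex 0 (ex_intro (fun p => C p /\ `|x - p| = dist x C) p Pp)).
Qed.

Lemma proj_in x C : closed C -> C !=set0 -> C (proj C x).
Proof. by move=> clC C0; have [] := projP x clC C0. Qed.

Lemma dist_proj x C : closed C -> C !=set0 -> dist x C = `|x - proj C x|.
Proof. by move=> clC C0; have [] := projP x clC C0. Qed.

Lemma dist_ge0 x C : C !=set0 -> 0 <= dist x C.
Proof. by move=> C0; apply: le_dist. Qed.

Lemma dist_eq0 x C : C x -> dist x C = 0.
Proof.
move=> Cx; apply/eqP; rewrite eq_le dist_ge0 ?andbT; last by exists x.
by rewrite (le_trans (dist_le x Cx)) // subrr normr0.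
Qed.

(** The variational inequality of the projection p: moving from p towards y
    inside C cannot decrease the distance to x, so the derivative of the squared
    distance in that direction is nonnegative. *)
Lemma proj_obtuse x C y : closed C -> convex_set C -> C y ->
  '[x - proj C x, y - proj C x] <= 0.
Proof.
move=> clC cC Cy; have C0 : C !=set0 by exists y.
have [Cp xp] := projP x clC C0; set p := proj C x in Cp xp *.
suff : 2 * '[x - p, y - p] <= 0 by lra.
apply: (@le0_of_small_multiples _ (`|y - p| ^+ 2)) => t /andP[t0 t1].
have Cq : C (p + t *: (y - p)).
  by apply: convex_set_segment => //; rewrite t1 ltW.
have : `|x - p| ^+ 2 <= `|x - (p + t *: (y - p))| ^+ 2.
  by rewrite lerXn2r ?nnegrE // xp; exact: dist_le.
rewrite opprD addrA [leRHS]sqr_normB innerZr normrZ exprMn.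
rewrite (ger0_norm (ltW t0)) => h.
by rewrite -(ler_pM2l t0); lra.
Qed.

(** The converse of [proj_obtuse]: the variational inequality identifies the
    nearest point. *)
Lemma dist_of_obtuse x C p : C p -> (forall y, C y -> '[x - p, y - p] <= 0) ->
  dist x C = `|x - p|.
Proof.
move=> Cp h; apply/eqP; rewrite eq_le dist_le //= le_dist //; first by exists p.
move=> q Cq; rewrite -ler_sqr ?nnegrE //.
have -> : x - q = (x - p) - (q - p) by rewrite opprB addrA subrK.
rewrite [leRHS]sqr_normB; have := h q Cq; have := sqr_ge0 `|q - p|; lra.
Qed.

(** The triangle x, P_C x, y has an obtuse angle at P_C x. *)
Lemma proj_pythagoras x C y : closed C -> convex_set C -> C y ->
  `|x - proj C x| ^+ 2 + `|proj C x - y| ^+ 2 <= `|x - y| ^+ 2.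
Proof.
move=> clC cC Cy; have := proj_obtuse x clC cC Cy; set p := proj C x.
have -> : x - y = (x - p) - (y - p) by rewrite opprB addrA subrK.
move=> h; rewrite (distrC p y) [leRHS]sqr_normB; lra.
Qed.

Lemma proj_nearer x C y : closed C -> convex_set C -> C y ->
  `|proj C x - y| <= `|x - y|.
Proof.
move=> clC cC Cy; rewrite -ler_sqr ?nnegrE //.
have := proj_pythagoras x clC cC Cy.
by have := sqr_ge0 `|x - proj C x|; lra.
Qed.

End Projection.
(** * Angle bounds and the contraction of distances *)

Section Regularity.
Context {R : realType} {E : euclideanType R}.
Implicit Types (A B C : set E) (x y z p a b : E) (q t kappa : R).

Lemma convex_setI A B : convex_set A -> convex_set B -> convex_set (A `&` B).
Proof.
move=> cA cB x y l /set_mem[Ax Bx] /set_mem[Ay By]; apply/mem_set; split.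
  exact/set_mem/(cA _ _ _ (mem_set Ax) (mem_set Ay)).
exact/set_mem/(cB _ _ _ (mem_set Bx) (mem_set By)).
Qed.

(** With z the projection of a on the intersection, q bounds the cosine of the
    angle at z between a and any point of B. *)
Definition angle_bound q A B : Prop := forall a b, A a -> B b ->
  let z := proj (A `&` B) a in '[a - z, b - z] <= q * `|a - z| * `|b - z|.

(** The whole ray from P_C x through x is normal to C at P_C x, so that all its
    points project to P_C x. *)
Lemma dist_homothety C x t : closed C -> convex_set C -> C !=set0 ->
  0 <= t -> dist (proj C x + t *: (x - proj C x)) C = t * dist x C.
Proof.
move=> clC cC C0 t0; have Cp := proj_in x clC C0.
rewrite (@dist_of_obtuse _ _ _ _ (proj C x)) //; last first.
  move=> y Cy; rewrite addrAC subrr add0r innerZl.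
  by rewrite mulr_ge0_le0 // proj_obtuse.
by rewrite addrAC subrr add0r normrZ ger0_norm // (dist_proj x clC C0).
Qed.

(** Let u = a - z and v = b - z.  For small t > 0, the point z + t u is at
    distance t |u| from C, and its orthogonal projection on the line through z
    and b falls on the segment [z, b], which lies in B.  The error bound thus
    says that the sine of the angle between u and v is at least 1 / kappa. *)
Lemma angle_bound_of_error_bound kappa A B :
  closed A -> convex_set A -> closed B -> convex_set B -> A `&` B !=set0 ->
  1 <= kappa ->
  (forall x, A x -> dist x (A `&` B) <= kappa * dist x B) ->
  angle_bound (Num.sqrt (1 - kappa ^- 2)) A B.
Proof.
move=> clA cA clB cB AB0 k1 eb a b Aa Bb /=.
have clC : closed (A `&` B) by exact: closedI.
have cC : convex_set (A `&` B) by exact: convex_setI.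
have [Az Bz] := proj_in a clC AB0.
have distC t := @dist_homothety _ a t clC cC AB0.
have da := dist_proj a clC AB0.
set z := proj (A `&` B) a in Az Bz distC da *.
set q := Num.sqrt _; set u := a - z in distC da *.
have -> : b = z + (b - z) by rewrite addrC subrK.
set v := b - z; rewrite [z + v]addrC addrK.
(* Unless the angle is acute, there is nothing to prove. *)
have [i0|i0] := leP '[u, v] 0.
  by rewrite (le_trans i0) // !mulr_ge0 // sqrtr_ge0.
have v0 : 0 < `|v| ^+ 2.
  rewrite exprn_gt0 // normr_gt0; apply/eqP => v0.
  by move: i0; rewrite v0 inner0r ltxx.
pose t := Num.min 1 (`|v| ^+ 2 / '[u, v]).
have t0 : 0 < t by rewrite lt_min ltr01 divr_gt0.
have t1 : t <= 1 by rewrite ge_min lexx.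
have tv : t * '[u, v] <= `|v| ^+ 2.
  by rewrite -ler_pdivlMr // ge_min lexx orbT.
(* z + m v is the orthogonal projection of z + t u on the line through z and b;
   the choice of t ensures m <= 1. *)
have [m mE] : {m | m = t * '[u, v] / `|v| ^+ 2} by eexists.
have m01 : 0 <= m <= 1.
  rewrite mE divr_ge0 ?mulr_ge0 ?(ltW t0) ?(ltW i0) ?(ltW v0) //=.
  by rewrite ler_pdivrMr // mul1r.
have Ax : A (z + t *: u) by apply: convex_set_segment; rewrite ?t1 ?ltW.
have By : B (z + m *: v) by exact: convex_set_segment.
have k0 : 0 < kappa by exact: lt_le_trans k1.
have : t * `|u| <= kappa * `|t *: u - m *: v|.
  have := eb _ Ax; rewrite (distC _ (ltW t0)) da => /le_trans; apply.
  rewrite ler_pM2l // (le_trans (dist_le _ By)) //.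
  by rewrite opprD addrACA subrr add0r.
rewrite -ler_sqr ?nnegrE ?mulr_ge0 ?(ltW t0) ?(ltW k0) //.
rewrite !exprMn (sqr_normB (t *: u)) innerZl innerZr.
rewrite !normrZ !exprMn !real_normK ?num_real //.
have -> : t ^+ 2 * `|u| ^+ 2 - 2 * (t * (m * '[u, v])) + m ^+ 2 * `|v| ^+ 2 =
    t ^+ 2 * (`|u| ^+ 2 - '[u, v] ^+ 2 / `|v| ^+ 2).
  by rewrite mE; field; move: v0; rewrite lt_neqAle eq_sym sqrf_eq0 => /andP[].
rewrite (mulrCA (kappa ^+ 2)) ler_pM2l ?exprn_gt0 // => h.
have q2 : q ^+ 2 = 1 - kappa ^- 2.
  by rewrite sqr_sqrtr // subr_ge0 invf_le1 ?exprn_gt0 // expr_ge1 // ltW.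
rewrite -ler_sqr ?nnegrE ?(ltW i0) // ?mulr_ge0 ?sqrtr_ge0 //.
rewrite !exprMn q2 -ler_pdivrMr // mulrBl mul1r lerBrDr -lerBrDl.
by rewrite mulrC ler_pdivrMr ?exprn_gt0 // mulrC.
Qed.

(** Let w = P_C b, u = a - w and v = b - w.  For small t, let x = w + t u, a
    point of A, let z = P_C x and s = z - w.  Both s and x - z have length at
    most t |u|, and v makes an obtuse angle with s, so
    t <u, v> <= <x - z, v>.  Up to an error of order t^2, the right-hand side is
    <x - z, b - z>, which the angle bound at z estimates by
    q t |u| |v|.  Divide by t and let t tend to 0. *)
Lemma angle_bound_sym q A B :
  closed A -> convex_set A -> closed B -> convex_set B -> A `&` B !=set0 ->
  0 <= q -> angle_bound q A B -> angle_bound q B A.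
Proof.
move=> clA cA clB cB AB0 q0 ab b a Bb Aa /=.
have clC : closed (A `&` B) by exact: closedI.
have cC : convex_set (A `&` B) by exact: convex_setI.
rewrite (setIC B A).
have Cw := proj_in b clC AB0.
have obw y := @proj_obtuse _ _ b _ y clC cC.
set w := proj (A `&` B) b in Cw obw *.
have -> : a = w + (a - w) by rewrite addrC subrK.
set u := a - w; rewrite [w + u]addrC addrK; set v := b - w in obw *.
rewrite -subr_le0; apply: (@le0_of_small_multiples _ _ ((q + 1) * `|u| ^+ 2)).
move=> t /andP[t0 t1].
pose x := w + t *: u.
have Ax : A x by apply: convex_set_segment; rewrite ?t1 ?ltW //; case: Cw.
have Cz := proj_in x clC AB0.
have py := proj_pythagoras x clC cC Cw.
have obz := proj_obtuse x clC cC Cw.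
have := ab x b Ax Bb; rewrite /=.
set z := proj (A `&` B) x in Cz py obz *.
have obs := obw z Cz; move: obs py obz.
set s := z - w.
have -> : w - z = - s by rewrite opprB.
have -> : b - z = v - s by rewrite opprB addrA subrK.
have -> : x - w = t *: u by rewrite /x [w + _]addrC addrK.
have -> : x - z = t *: u - s by rewrite /x /s opprB addrA [t *: u + w]addrC.
set r := t *: u - s => vs py; rewrite innerNr oppr_le0 => rs.
rewrite innerDr innerNr => ang.
have tu : `|t *: u| = t * `|u| by rewrite normrZ gtr0_norm.
have s_le : `|s| <= t * `|u|.
  by rewrite -tu -ler_sqr ?nnegrE //; have := sqr_ge0 `|r|; lra.
have r_le : `|r| <= t * `|u|.
  by rewrite -tu -ler_sqr ?nnegrE //; have := sqr_ge0 `|s|; lra.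
have rs_le := inner_le_norm r s.
have vs_le : `|v - s| <= `|v| + `|s| by exact: ler_normB.
have uv : t * '[v, u] = '[r, v] + '[v, s].
  by rewrite (innerC v u) -innerZl -[t *: u](subrK s) innerDl (innerC s v).
have b1 : q * `|r| * `|v - s| <= q * (t * `|u|) * (`|v| + t * `|u|).
  apply: ler_pM => //; [exact: mulr_ge0|exact: ler_wpM2l|].
  by rewrite (le_trans vs_le) // lerD2l.
have b2 : `|r| * `|s| <= (t * `|u|) * (t * `|u|) by exact: ler_pM.
rewrite -(ler_pM2l t0) mulrBr uv.
have -> : t * (t * ((q + 1) * `|u| ^+ 2)) =
    q * (t * `|u|) * (`|v| + t * `|u|) + (t * `|u|) * (t * `|u|) -
    t * (q * `|v| * `|u|) by ring.
by lra.
Qed.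

(** Let w = P_C x and b = P_B x.  The triangle x, b, w has an obtuse angle at b,
    so |b - w| is at most |x - w| times the cosine of the angle at w. *)
Lemma dist_proj_contraction q A B x :
  closed A -> convex_set A -> closed B -> convex_set B -> A `&` B !=set0 ->
  0 <= q -> angle_bound q A B -> A x ->
  dist (proj B x) (A `&` B) <= q * dist x (A `&` B).
Proof.
move=> clA cA clB cB AB0 q0 ab Ax.
have clC : closed (A `&` B) by exact: closedI.
have B0 : B !=set0 by case: AB0 => y [_ By]; exists y.
have Cw := proj_in x clC AB0.
have := ab x _ Ax (proj_in x clB B0); rewrite /= (dist_proj x clC AB0).
set w := proj (A `&` B) x in Cw *.
have := proj_obtuse x clB cB (proj2 Cw); set b := proj B x.
have -> : x - b = (x - w) - (b - w) by rewrite opprB addrA subrK.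
rewrite -(opprB b w) innerNr innerDl innerNl -sqr_normE => ob ang.
apply: (le_trans (dist_le _ Cw)).
have [->|v0] := eqVneq `|b - w| 0; last first.
  have v1 : 0 < `|b - w| by rewrite lt_neqAle eq_sym v0 /=.
  by rewrite -(ler_pM2r v1) -expr2; lra.
by rewrite mulr_ge0.
Qed.

End Regularity.
(** * Real sequences *)

Section Sequences.
Context {R : realType}.
Implicit Types (a c r M : R) (e : nat -> R).

Lemma le0_of_geometric_bound a M r : 0 <= r < 1 ->
  (forall k, a <= M * r ^+ k) -> a <= 0.
Proof.
move=> /andP[r0 r1] h.
have r_lt1 : `|r| < 1 by rewrite ger0_norm.
have g := cvg_geometric M r_lt1.
by rewrite -(cvg_lim _ g) //; apply: limr_ge; [exact: cvgP g|exact: nearW].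
Qed.

(** The ratios of consecutive terms of a log-convex sequence increase.  If one
    of them, r, exceeded c, the sequence would from there on grow at least as
    r^i, against the bound by a multiple of c^i. *)
Lemma ratio_le_of_log_convex e c M p : 0 <= c ->
  (forall k, 0 <= e k) -> (forall k, e k.+1 ^+ 2 <= e k * e k.+2) ->
  (forall i, e (p + i)%N <= M * c ^+ i) ->
  forall k, e k.+1 <= c * e k.
Proof.
move=> c0 e0 lc eM k; rewrite leNgt; apply/negP => ck.
have ek : 0 < e k.
  rewrite lt_neqAle e0 andbT eq_sym; apply/eqP => ek.
  have := lc k; rewrite ek mul0r => h.
  by move: ck; rewrite ek mulr0; have := sqr_ge0 (e k.+1); nra.
pose r := e k.+1 / e k.
have cr : c < r by rewrite ltr_pdivlMr.
have r0 : 0 < r by exact: le_lt_trans cr.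
have growth i : 0 < e (k + i)%N /\ r * e (k + i)%N <= e (k + i).+1.
  elim: i => [|i [epos IH]]; first by rewrite addn0 ek /r divfK ?gt_eqF.
  have e1 : 0 < e (k + i).+1 by apply: lt_le_trans IH; exact: mulr_gt0.
  rewrite addnS; split=> //; rewrite -(ler_pM2l epos).
  apply: le_trans (lc (k + i)%N).
  by rewrite (mulrCA (e (k + i)%N)) mulrA expr2 ler_pM2r.
have lower i : r ^+ i * e k <= e (k + i)%N.
  elim: i => [|i IH]; first by rewrite expr0 mul1r addn0.
  rewrite addnS; apply: le_trans (proj2 (growth i)).
  by rewrite exprS -mulrA ler_pM2l.
clearbody r.
have : r ^+ p * e k <= 0.
  apply: (@le0_of_geometric_bound _ (M * c ^+ k) (c / r)).
    by rewrite divr_ge0 ?(ltW r0) //= ltr_pdivrMr // mul1r.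
  move=> i; rewrite expr_div_n mulrA ler_pdivlMr ?exprn_gt0 //.
  rewrite mulrAC -exprD -mulrA -exprD.
  by apply: le_trans (lower _) _; rewrite addnCA; exact: eM.
by rewrite leNgt mulr_gt0 // exprn_gt0.
Qed.

(** Log-convexity is inherited by the subsequence of every second term: the
    outer two inequalities multiply to (d1 d3)^2 <= d0 d2^2 d4, and d2^4 is at
    most the left-hand side. *)
Lemma log_convex_even (d0 d1 d2 d3 d4 : R) :
  0 <= d0 -> 0 <= d2 -> 0 <= d4 ->
  d1 ^+ 2 <= d0 * d2 -> d2 ^+ 2 <= d1 * d3 -> d3 ^+ 2 <= d2 * d4 ->
  d2 ^+ 2 <= d0 * d4.
Proof.
move=> p0 p2 p4 h1 h2 h3.
have [->|d2n0] := eqVneq d2 0; first by rewrite expr0n /= mulr_ge0.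
have d2p : 0 < d2 ^+ 2 by rewrite exprn_gt0 // lt_neqAle eq_sym d2n0.
rewrite -(ler_pM2r d2p).
apply: (@le_trans _ _ ((d1 * d3) ^+ 2)).
  by rewrite -expr2 ler_sqr ?nnegrE ?(ltW d2p) // (le_trans _ h2) // ltW.
rewrite exprMn (_ : d0 * d4 * d2 ^+ 2 = (d0 * d2) * (d2 * d4)); last by ring.
by apply: ler_pM => //; exact: sqr_ge0.
Qed.

End Sequences.

(** * From local to global error bounds, and Fejer monotone sequences *)

Section Convergence.
Context {R : realType} {E : euclideanType R}.
Implicit Types (A B C : set E) (x y z p a b : E) (c q t kappa : R)
  (u : nat -> E).

Lemma small_step_in_ball x y (e : R) : 0 < e ->
  exists2 t, 0 < t <= 1 & ball y e (y + t *: (x - y)).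
Proof.
move=> e0; pose n := `|x - y| + 1.
have n0 : 0 < n by rewrite ltr_wpDl.
exists (Num.min 1 (e / n)).
  by rewrite lt_min ltr01 divr_gt0 //= ge_min lexx.
rewrite -ball_normE /= opprD addrA subrr add0r normrN normrZ.
have t0 : 0 < Num.min 1 (e / n) by rewrite lt_min ltr01 divr_gt0.
rewrite gtr0_norm //; apply: (@lt_le_trans _ _ (Num.min 1 (e / n) * n)).
  by rewrite ltr_pM2l // ltrDl.
by rewrite -ler_pdivlMr // ge_min lexx orbT.
Qed.

(** For x in A outside C, the point y = P_C x lies on the boundary of C, because
    the half-open segment from y to x avoids C.  A point y + t (x - y) close to
    y satisfies the local estimate; its distance to C is t dist(x, C), and its
    distance to B is at most t dist(x, B) by convexity of B.  Divide by t. *)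
Lemma error_bound_of_local kappa A B :
  closed A -> convex_set A -> closed B -> convex_set B -> A `&` B !=set0 ->
  (forall x, boundary (A `&` B) x -> (sr' A B x <= kappa%:E)%E) ->
  forall x, A x -> dist x (A `&` B) <= kappa * dist x B.
Proof.
move=> clA cA clB cB AB0 srk x Ax.
have clC : closed (A `&` B) by exact: closedI.
have cC : convex_set (A `&` B) by exact: convex_setI.
have B0 : B !=set0 by case: AB0 => y [_ By]; exists y.
have [Cx|nCx] := pselect ((A `&` B) x).
  by rewrite !dist_eq0 ?mulr0 //; case: Cx.
have distC t := @dist_homothety _ _ _ x t clC cC AB0.
have Cy := proj_in x clC AB0.
have d0 : 0 < dist x (A `&` B).
  rewrite (dist_proj x clC AB0) normr_gt0 subr_eq0; apply/eqP => xy.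
  by apply: nCx; rewrite xy.
set y := proj (A `&` B) x in distC Cy.
have bdy : boundary (A `&` B) y.
  split; first exact: subset_closure.
  rewrite /interior => /nbhs_ballP[e /= e0 yeC].
  have [t /andP[t0 _] /yeC Ct] := small_step_in_ball x y e0.
  have := distC _ (ltW t0); rewrite dist_eq0 // => /esym/eqP.
  by rewrite mulf_eq0 !gt_eqF.
apply/ler_addgt0Pr => e e0.
pose D := dist x B.
have D0 : 0 <= D by exact: dist_ge0.
have eD0 : 0 < e / (D + 1) by rewrite divr_gt0 // ltr_wpDl.
(* The infimum defining sr' need not be attained; this slack costs at most e
   after multiplication by D. *)
have : (sr' A B y < (kappa + e / (D + 1))%:E)%E.
  by apply: le_lt_trans (srk _ bdy) _; rewrite lte_fin ltrDl.
move=> /ereal_inf_lt[_ [k [k0 [delta delta0 loc]] <-]]; rewrite lte_fin => kk.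
have [t /andP[t0 t1] tball] := small_step_in_ball x y delta0.
have At : A (y + t *: (x - y)).
  by apply: convex_set_segment; rewrite ?t1 ?(ltW t0) //; case: Cy.
have := loc _ At tball; rewrite (distC _ (ltW t0)) => h.
have tB : dist (y + t *: (x - y)) B <= t * D.
  have Bt : B (y + t *: (proj B x - y)).
    apply: convex_set_segment; rewrite ?t1 ?(ltW t0) //; first by case: Cy.
    exact: proj_in.
  apply: (le_trans (dist_le _ Bt)).
  rewrite opprD addrACA subrr add0r -scalerBr opprB addrA subrK normrZ.
  by rewrite gtr0_norm // /D (dist_proj x clB B0).
have {h tB} : dist x (A `&` B) <= k * D.
  by rewrite -(ler_pM2l t0) mulrCA (le_trans h) // ler_wpM2l.
move=> /le_trans; apply.
apply: (@le_trans _ _ ((kappa + e / (D + 1)) * D)).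
  by rewrite ler_wpM2r // ltW.
rewrite mulrDl lerD2l mulrAC ler_pdivrMr ?ltr_wpDl //.
by rewrite mulrDr mulr1 lerDl ltW.
Qed.

(** By Fejer monotonicity with respect to P_C (u k), all later terms remain
    within dist(u k, C) of that point, hence within twice that distance of u k.
    So does any cluster point, which exists by compactness; it is therefore the
    limit, and it is at distance 0 from C. *)
Lemma Fejer_Rlinear_cvg C u M r : closed C -> C !=set0 -> 0 <= r < 1 ->
  (forall y k, C y -> `|u k.+1 - y| <= `|u k - y|) ->
  (forall k, dist (u k) C <= M * r ^+ k) ->
  exists2 xt, C xt & forall k, `|u k - xt| <= 2 * (M * r ^+ k).
Proof.
move=> clC C0 r01 fejer dM.
have fejer' y k i : C y -> `|u (k + i)%N - y| <= `|u k - y|.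
  move=> Cy; elim: i => [|i IH]; first by rewrite addn0.
  by rewrite addnS (le_trans (fejer _ _ Cy)).
have tail k i : `|u k - u (k + i)%N| <= 2 * (M * r ^+ k).
  have Cp := proj_in (u k) clC C0; have dp := dist_proj (u k) clC C0.
  rewrite -(subrKA (proj C (u k))) (le_trans (ler_normD _ _)) //.
  rewrite mulr2n mulrDl !mul1r lerD // -?dp ?dM //.
  by rewrite distrC (le_trans (fejer' _ _ _ Cp)) // -dp.
have inball : (u @ \oo) [set x | `|x| <= `|u 0%N| + 2 * (M * r ^+ 0)].
  exists 0%N => // k _ /=.
  rewrite -{1}(subKr (u 0%N) (u k)) (le_trans (ler_normB _ _)) // lerD2l.
  exact: (tail 0%N k).
have [xt [_ clu]] := @closed_ball_compact R E _ (u @ \oo) _ inball.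
have lim k : `|u k - xt| <= 2 * (M * r ^+ k).
  have : closed [set y | `|u k - y| <= 2 * (M * r ^+ k)].
    have cont : continuous (fun y : E => `|u k - y|).
      move=> y; apply: (@continuous_comp _ _ _ (fun y => u k - y) (fun y : E => `|y|)).
        by apply: continuousB; [exact: cst_continuous|exact: id].
      exact: norm_continuous.
    have /continuous_closedP h := cont.
    exact: (h _ (@closed_le _ _)).
  apply => V nV; apply: clu => //.
  exists k => // j /= kj; by rewrite -(subnKC kj).
exists xt => //.
have Cp := proj_in xt clC C0.
suff /eqP : `|xt - proj C xt| = 0 by rewrite normr_eq0 subr_eq0 => /eqP ->.
apply: le_anti; rewrite normr_ge0 andbT.
apply: (le0_of_geometric_bound (M := 3 * M) r01) => k.
rewrite -(dist_proj xt clC C0) (le_trans (dist_le _ (proj_in (u k) clC C0))) //.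
rewrite -(subrKA (u k)) (le_trans (ler_normD _ _)) //.
have := lim k; rewrite distrC; have := dM k; rewrite (dist_proj (u k) clC C0).
lra.
Qed.

End Convergence.
(** * Alternating projections *)

Section AlternatingProjections.
Context {R : realType} {E : euclideanType R}.
Implicit Types (A B C : set E) (x y z p a b : E) (c q t kappa : R)
  (u : nat -> E).

(** With b' = P_B a, the variational inequalities of P_A at b and of P_B at x add
    up to |b - a|^2 <= <b - x, b' - a>. *)
Lemma gap_log_convex A B x :
  closed A -> convex_set A -> closed B -> convex_set B -> A `&` B !=set0 ->
  A x -> let b := proj B x in let a := proj A b in
  `|b - a| ^+ 2 <= `|x - b| * `|a - proj B a|.
Proof.
move=> clA cA clB cB AB0 Ax /=; set b := proj B x; set a := proj A b.
have B0 : B !=set0 by case: AB0 => y [_ By]; exists y.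
have h1 := proj_obtuse b clA cA Ax.
have h2 := proj_obtuse x clB cB (proj_in a clB B0).
rewrite -/a -/b in h1 h2; set b' := proj B a in h2 *.
have -> : `|x - b| * `|a - b'| = `|b - x| * `|b' - a| by rewrite distrC (distrC a).
apply: le_trans (inner_le_norm _ _); rewrite sqr_normE.
have e1 : x - b = (x - a) - (b - a) by rewrite opprB addrA subrK.
have e2 : b' - b = (b' - a) - (b - a) by rewrite opprB addrA subrK.
have e3 : b - x = (b - a) - (x - a) by rewrite opprB addrA subrK.
move: h1 h2; rewrite e1 e2 e3.
move: (x - a) (b - a) (b' - a) => X P Q.
rewrite !inner_expand (innerC P X) (innerC P Q); lra.
Qed.

(** [gap_log_convex] at three consecutive points, alternately with the roles of
    A and B exchanged, controls five consecutive gaps; those starting in A are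
    the first, the third and the fifth. *)
Lemma gap_two_step_log_convex A B x :
  closed A -> convex_set A -> closed B -> convex_set B -> A `&` B !=set0 ->
  A x -> let T z := proj A (proj B z) in
  dist (T x) B ^+ 2 <= dist x B * dist (T (T x)) B.
Proof.
move=> clA cA clB cB AB0 Ax /=; set T := fun z => proj A (proj B z).
have A0 : A !=set0 by case: AB0 => y [Ay _]; exists y.
have B0 : B !=set0 by case: AB0 => y [_ By]; exists y.
have BA0 : B `&` A !=set0 by rewrite setIC.
have AT z : A (T z) by exact: proj_in.
have BP z : B (proj B z) by exact: proj_in.
have h1 := gap_log_convex clA cA clB cB AB0 Ax.
have h2 := gap_log_convex clB cB clA cA BA0 (BP x).
have h3 := gap_log_convex clA cA clB cB AB0 (AT x).
rewrite /= in h1 h2 h3.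
rewrite !(dist_proj _ clB B0).
exact: (log_convex_even _ _ _ h1 h2 h3).
Qed.

Lemma alternating_projections_in A B u k : closed A -> A !=set0 ->
  alternating_projections A B u -> A (u k).
Proof. by move=> clA A0 [Au0 uS]; case: k => [//|k]; rewrite uS; exact: proj_in. Qed.

Lemma alternating_projections_exists A B x : A x ->
  exists2 u, alternating_projections A B u & u 0%N = x.
Proof. by move=> Ax; exists (fun k => iter k (fun z => proj A (proj B z)) x). Qed.

(** Each of P_B and P_A contracts the distance to the intersection by q, the
    second one thanks to the symmetry of the angle bound. *)
Lemma Rlinear_cvg_of_angle_bound A B q u :
  closed A -> convex_set A -> closed B -> convex_set B -> A `&` B !=set0 ->
  0 <= q < 1 -> angle_bound q A B -> alternating_projections A B u ->
  exists2 xt, (A `&` B) xt & Rlinear_cvg u xt (q ^+ 2).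
Proof.
move=> clA cA clB cB AB0 /andP[q0 q1] ab apu.
have clC : closed (A `&` B) by exact: closedI.
have A0 : A !=set0 by case: AB0 => y [Ay _]; exists y.
have B0 : B !=set0 by case: AB0 => y [_ By]; exists y.
have BA0 : B `&` A !=set0 by rewrite setIC.
have Au k := alternating_projections_in k clA A0 apu.
case: (apu) => _ uS.
have q2 : 0 <= q ^+ 2 < 1 by rewrite sqr_ge0 /= expr_lt1.
have step k : dist (u k.+1) (A `&` B) <= q ^+ 2 * dist (u k) (A `&` B).
  have h1 := dist_proj_contraction clA cA clB cB AB0 q0 ab (Au k).
  have := dist_proj_contraction clB cB clA cA BA0 q0
    (angle_bound_sym clA cA clB cB AB0 q0 ab) (proj_in (u k) clB B0).
  rewrite setIC -uS => /le_trans; apply.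
  by rewrite expr2 -mulrA ler_wpM2l.
pose M := dist (u 0%N) (A `&` B).
have dM k : dist (u k) (A `&` B) <= M * (q ^+ 2) ^+ k.
  elim: k => [|k IH]; first by rewrite expr0 mulr1.
  by rewrite (le_trans (step k)) // [_ ^+ k.+1]exprS mulrCA ler_wpM2l // sqr_ge0.
have fejer y k : (A `&` B) y -> `|u k.+1 - y| <= `|u k - y|.
  move=> [Ay By]; rewrite uS.
  exact: le_trans (proj_nearer _ clA cA Ay) (proj_nearer _ clB cB By).
have [xt Cxt lim] := Fejer_Rlinear_cvg clC AB0 q2 fejer dM.
exists xt => //; split=> //; have M0 : 0 <= M by exact: dist_ge0.
(* The added 1 keeps the constant positive when u 0 is already in C. *)
exists (2 * M + 1) => [|k]; first by rewrite ltr_wpDl // mulr_ge0.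
rewrite (le_trans (lim k)) // mulrA ler_wpM2r ?lerDl //.
by apply: exprn_ge0; case/andP: q2.
Qed.

(** The eventual rate forces the gaps dist(u k, B) to decrease by the factor c
    from the very first step; they bound the steps |u k - u (k + 1)|, whose sum
    bounds the distance from u 0 to the limit. *)
Lemma error_bound_of_eventually_Rlinear_cvg A B c u xt :
  closed A -> convex_set A -> closed B -> convex_set B -> A `&` B !=set0 ->
  alternating_projections A B u -> (A `&` B) xt ->
  eventually_Rlinear_cvg u xt c ->
  `|u 0%N - xt| <= 1 / (1 - c) * dist (u 0%N) B.
Proof.
move=> clA cA clB cB AB0 apu [Axt Bxt] [/andP[c0 c1] [p [g g0 lim]]].
have A0 : A !=set0 by exists xt.
have B0 : B !=set0 by exists xt.
have Au k := alternating_projections_in k clA A0 apu.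
case: (apu) => _ uS.
pose e k := dist (u k) B.
have lc k : e k.+1 ^+ 2 <= e k * e k.+2.
  by rewrite /e !uS; exact: gap_two_step_log_convex.
have e0 k : 0 <= e k by exact: dist_ge0.
have lim' i : `|u (p + i)%N - xt| <= g * c ^+ i.
  by have := lim (p + i)%N (leq_addr _ _); rewrite addKn.
have ratio := ratio_le_of_log_convex c0 e0 lc
  (fun i => le_trans (dist_le _ Bxt) (lim' i)).
have geom k : e k <= c ^+ k * e 0%N.
  elim: k => [|k IH]; first by rewrite expr0 mul1r.
  by rewrite (le_trans (ratio k)) // exprS -mulrA ler_wpM2l.
have step k : `|u k - u k.+1| <= e k.
  by rewrite /e (dist_proj _ clB B0) uS distrC [leRHS]distrC; exact: proj_nearer.
have c1' : 0 < 1 - c by rewrite subr_gt0.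
have partial k : (1 - c) * `|u 0%N - u k| <= (1 - c ^+ k) * e 0%N.
  elim: k => [|k IH]; first by rewrite subrr normr0 mulr0 expr0 subrr mul0r.
  apply: (@le_trans _ _ ((1 - c) * (`|u 0%N - u k| + c ^+ k * e 0%N))).
    rewrite ler_pM2l // -(subrKA (u k)) (le_trans (ler_normD _ _)) // lerD2l.
    exact: le_trans (step k) (geom k).
  by rewrite exprS; lra.
rewrite div1r ler_pdivlMl // -subr_le0.
(* Compare with the iterate of index p + i, whose distance to xt vanishes as i
   grows. *)
apply: (@le0_of_geometric_bound _ _ ((1 - c) * g) c); first by rewrite c0.
move=> i; rewrite lerBlDr -mulrA.
apply: (@le_trans _ _ ((1 - c) * (`|u (p + i)%N - xt| + `|u 0%N - u (p + i)%N|))).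
  by rewrite ler_pM2l // [leRHS]addrC -(subrKA (u (p + i)%N)) ler_normD.
rewrite mulrDr lerD ?ler_pM2l //.
rewrite (le_trans (partial _)) // ler_piMl // gerBl exprn_ge0 //.
Qed.

End AlternatingProjections.

Theorem theorem5p5 (R : realType) (E : euclideanType R) (A B : set E)
    (closedA : closed A) (convexA : convex_set A)
    (closedB : closed B) (convexB : convex_set B)
    (AB_nonempty : A `&` B !=set0) :
  (forall kappa : R,
     (forall x, boundary (A `&` B) x -> subtransversal A B x) ->
     (forall x, boundary (A `&` B) x -> (sr' A B x <= kappa%:E)%E) ->
     forall c : R, 0 <= c < 1 -> (1 - inv_sqr kappa < c%:E)%E ->
     forall u : nat -> E, alternating_projections A B u ->
     exists xt : E, (A `&` B) xt /\
       exists2 c' : R, c' <= c & Rlinear_cvg u xt c')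
  /\
  (forall c : R, 0 <= c < 1 ->
     (forall u : nat -> E, alternating_projections A B u ->
        exists xt : E, (A `&` B) xt /\
          exists2 c' : R, c' <= c & eventually_Rlinear_cvg u xt c') ->
     forall x, A x -> dist x (A `&` B) <= 1 / (1 - c) * dist x B).
Proof.
split=> [kappa _ srk c /andP[c0 c1] kc u apu|c /andP[c0 c1] cvg x Ax].
  (* Replacing kappa by K makes 1 - K^-2 nonnegative; it is still at most c,
     since it vanishes when kappa <= 1. *)
  pose K := Num.max kappa 1.
  have K1 : 1 <= K by rewrite le_max lexx orbT.
  have B0 : B !=set0 by case: AB_nonempty => y [_ By]; exists y.
  have eb x : A x -> dist x (A `&` B) <= K * dist x B.
    move=> Ax; apply: le_trans (error_bound_of_local _ _ _ _ _ srk Ax) _ => //.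
    by rewrite ler_wpM2r ?dist_ge0 // le_max lexx.
  pose q := Num.sqrt (1 - K ^- 2).
  have Kpos : 0 < K by exact: lt_le_trans K1.
  have q2 : q ^+ 2 = 1 - K ^- 2.
    by rewrite sqr_sqrtr // subr_ge0 invf_le1 ?exprn_gt0 // expr_ge1 // ltW.
  have q01 : 0 <= q < 1.
    rewrite sqrtr_ge0 /= -(@expr_lt1 _ 2%N) ?sqrtr_ge0 // q2.
    by rewrite gtrBl invr_gt0 exprn_gt0.
  have [xt Cxt xtlim] := Rlinear_cvg_of_angle_bound closedA convexA closedB
    convexB AB_nonempty q01 (angle_bound_of_error_bound closedA convexA closedB
      convexB AB_nonempty K1 eb) apu.
  exists xt; split=> //; exists (q ^+ 2) => //; rewrite q2.
  have [k1|k1] := leP kappa 1.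
    by rewrite /K max_r // expr1n invr1 subrr.
  move: kc; rewrite /inv_sqr gt_eqF ?(lt_trans ltr01) //.
  by rewrite /K max_l ?(ltW k1) // -EFinB lte_fin => /ltW.
have [u apu ux] := alternating_projections_exists B Ax.
have [xt [Cxt [c' c'c xtlim]]] := cvg u apu.
have c'1 : c' < 1 by exact: le_lt_trans c1.
rewrite (le_trans (dist_le _ Cxt)) // -ux.
apply: le_trans (error_bound_of_eventually_Rlinear_cvg _ _ _ _ _ apu Cxt xtlim) _ => //.
rewrite ler_wpM2r ?dist_ge0 //; first by case: Cxt => _ By; exists xt.
by rewrite !div1r lef_pV2 ?posrE ?subr_gt0 // lerD2l lerN2.
Qed.
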